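(* Let $\Gamma,\Delta$ be finite sets, let $W=\mathrm{Sym}(\Gamma)\wr\mathrm{Sym}(\Delta)$ act in product action on $\mathrm{Func}(\Delta,\Gamma)$, and let $B=\mathrm{Func}(\Delta,\mathrm{Sym}(\Gamma))$ be the base group of $W$. If $X$ is a subgroup of $W$ that is transitive on $\mathrm{Func}(\Delta,\Gamma)$, then for each $\delta\in\Delta$ the $\delta$-component of $X$ is transitive on $\Gamma$. Moreover, if in addition $X$ acts transitively on $\Delta$ (in the induced action), then for each $\delta\in\Delta$ the $\delta$-component of the intersection $X\cap B$ is transitive on $\Gamma$.
   Context: All actions are on the right: the image of $\delta$ under a map $f$ is written $\delta f$, and products are composed left to right. $\mathrm{Func}(A,C)$ denotes the set of all functions from $A$ to $C$. Wreath product. The base group $B=\mathrm{Func}(\Delta,\mathrm{Sym}(\Gamma))$ is a group under pointwise multiplication, $\delta(fg)=(\delta f)(\delta g)$. The group $\mathrm{Sym}(\Delta)$ acts on it by $\delta f^{h}=(\delta h^{-1})f$, and $W=\mathrm{Sym}(\Gamma)\wr\mathrm{Sym}(\Delta)$ is the semidirect product $B\rtimes\mathrm{Sym}(\Delta)$. Its elements are written uniquely as $fh$ with $f\in B$, $h\in\mathrm{Sym}(\Delta)$, and $h^{-1}fh=f^h$. Product action. For $\varphi\in\mathrm{Func}(\Delta,\Gamma)$ and $g=fh\in W$, the function $\varphi g$ is given by $\delta(\varphi g)=\big((\delta h^{-1})\varphi\big)\big((\delta h^{-1})f\big)$ for all $\delta\in\Delta$. Induced action and components. Let $X\leq W$.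 The induced action of $X$ on $\Delta$ is $fh:\delta\mapsto\delta h$. For $\delta\in\Delta$, the $\delta$-component of $X$ is the subgroup $\{\delta f : fh\in X,\ f\in B,\ h\in\mathrm{Sym}(\Delta),\ \delta h=\delta\}$ of $\mathrm{Sym}(\Gamma)$. The same definition applies to the subgroup $X\cap B$ of $W$, whose $\delta$-component is $\{\delta f : f\in X\cap B\}$. *)

(* Defs.v *)
From HB Require Import structures.
From mathcomp Require Import all_boot all_fingroup.

Set Implicit Arguments.
Unset Strict Implicit.
Unset Printing Implicit Defensive.

Local Open Scope group_scope.

(* Permutations act on the right: [s x] is the image of x under s, and
   [(s * t) x = t (s x)]. *)
Section WreathProduct.

Variables Gamma Delta : finType.

(* The dependent arrow {dffun ...} is used because it is the form of finite
   functions that the library equips with the pointwise group law. *)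
Definition base_type : finGroupType := {dffun forall _ : Delta, {perm Gamma}}.

Implicit Types (f : base_type) (h : {perm Delta}) (d : Delta).

Definition base_conj f h : base_type := [ffun d => f (h^-1 d)].

Lemma base_conj1 f : base_conj f 1 = f.
Proof. by apply/ffunP=> d; rewrite ffunE invg1 perm1. Qed.

Lemma base_conjM f : act_morph base_conj f.
Proof. by move=> h k; apply/ffunP=> d; rewrite !ffunE invMg permM. Qed.

Canonical base_action := TotalAction base_conj1 base_conjM.

Lemma base_is_groupAction : is_groupAction [set: base_type] base_action.
Proof.
move=> h _ /=; rewrite inE; apply/andP; split.
  by apply/subsetP=> f _; rewrite inE.
apply/morphicP=> f g _ _; rewrite !actpermE /=.
by apply/ffunP=> d; rewrite !ffunE.
Qed.

Definition base_gact := GroupAction base_is_groupAction.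

Definition wreath : finGroupType := sdprod_groupType base_gact.

Definition base_group : {group wreath} :=
  [group of sdpair1 base_gact @* [set: base_type]].

(* [sdpair1] and [sdpair2] inject the base group and Sym(Delta) into the wreath
   product: the element f h is [sdpair1 _ f * sdpair2 _ h].
   The pair (h, x) underlying an element of [sdprod_by] stands for h x.
   Since h x = x^(h^-1) h, its decomposition as f h has f = x^(h^-1). *)
Definition top_part (w : wreath) : {perm Delta} := (pair_of_sd w).1.
Definition base_part (w : wreath) : base_type :=
  base_conj (pair_of_sd w).2 (top_part w)^-1.

Lemma wreath_decomp (w : wreath) :
  w = sdpair1 base_gact (base_part w) * sdpair2 base_gact (top_part w).
Proof.
rewrite {1}[w]sdpairE conjgCV -(morphV (sdpair2_morphism base_gact)) ?inE //=.
by rewrite -sdpair_act ?inE.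
Qed.

Lemma top_partE f h :
  top_part (sdpair1 base_gact f * sdpair2 base_gact h) = h.
Proof. by rewrite /top_part /= !val_insubd !inE /= mul1g. Qed.

Lemma base_partE f h :
  base_part (sdpair1 base_gact f * sdpair2 base_gact h) = f.
Proof.
rewrite /base_part top_partE /= !val_insubd !inE /= mulg1.
by rewrite -base_conjM mulgV base_conj1.
Qed.

Lemma top_partM u v : top_part (u * v) = top_part u * top_part v.
Proof. by []. Qed.

Lemma base_partM u v :
  base_part (u * v) = base_part u * base_conj (base_part v) (top_part u)^-1.
Proof.
apply/ffunP=> d; rewrite /base_part top_partM /= !ffunE !invgK.
by rewrite permM permK.
Qed.

Lemma top_part1 : top_part 1 = 1.
Proof. by []. Qed.

Lemma base_part1 : base_part 1 = 1.
Proof. by apply/ffunP=> d; rewrite !ffunE. Qed.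

Lemma sdpair1_decomp f :
  sdpair1 base_gact f = sdpair1 base_gact f * sdpair2 base_gact 1.
Proof. by rewrite (morph1 (sdpair2_morphism base_gact)) mulg1. Qed.

Lemma mem_base_group (w : wreath) : (w \in base_group) = (top_part w == 1).
Proof.
apply/morphimP/eqP=> [[f _ _ ->] | tw1].
  by rewrite /= sdpair1_decomp top_partE.
exists (base_part w); rewrite ?inE //.
by rewrite {1}[w]wreath_decomp tw1 -sdpair1_decomp.
Qed.

Definition product_act_fun (phi : {ffun Delta -> Gamma}) (w : wreath) :
    {ffun Delta -> Gamma} :=
  let f := base_part w in let h := top_part w in
  [ffun d => f (h^-1 d) (phi (h^-1 d))].

Lemma product_act1 phi : product_act_fun phi 1 = phi.
Proof.
by apply/ffunP=> d; rewrite ffunE top_part1 base_part1 invg1 perm1 ffunE perm1.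
Qed.

Lemma product_actM phi : act_morph product_act_fun phi.
Proof.
move=> u v; apply/ffunP=> d; rewrite /product_act_fun top_partM base_partM.
rewrite invMg; move: (base_part u) (base_part v) => f g.
by rewrite !ffunE !permM invgK permKV.
Qed.

Canonical product_action := TotalAction product_act1 product_actM.

Definition induced_act_fun d (w : wreath) : Delta := top_part w d.

Lemma induced_act1 d : induced_act_fun d 1 = d.
Proof. by rewrite /induced_act_fun top_part1 perm1. Qed.

Lemma induced_actM d : act_morph induced_act_fun d.
Proof. by move=> u v; rewrite /induced_act_fun top_partM permM. Qed.

Canonical induced_action := TotalAction induced_act1 induced_actM.

Definition component (X : {set wreath}) d : {set {perm Gamma}} :=
  [set base_part w d | w in X & top_part w d == d].

Lemma component_group_set (X : {group wreath}) d : group_set (component X d).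
Proof.
apply/group_setP; split=> [|_ _ /imsetP[u /[!inE] /andP[Xu /eqP ud] ->]
                              /imsetP[v /[!inE] /andP[Xv /eqP vd] ->]].
  by apply/imsetP; exists 1; rewrite ?inE ?group1 ?top_part1 ?base_part1 
     ?perm1 ?ffunE ?eqxx.
apply/imsetP; exists (u * v).
  by rewrite inE groupM //= top_partM permM ud vd.
by rewrite base_partM !ffunE invgK ud.
Qed.

Canonical component_group (X : {group wreath}) d :=
  Group (component_group_set X d).

Lemma component_base (X : {set wreath}) d :
  component (X :&: base_group) d =
  [set f d | f : base_type in [set f | sdpair1 base_gact f \in X]].
Proof.
apply/setP=> s; apply/imsetP/imsetP=> [[w] | [f]].
  rewrite inE inE mem_base_group => /andP[/andP[Xw /eqP tw] _] ->.
  exists (base_part w); rewrite // inE.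
  by rewrite sdpair1_decomp -tw -wreath_decomp.
rewrite inE => Xf ->.
have tf: top_part (sdpair1 base_gact f) = 1.
  by apply/eqP; rewrite -mem_base_group mem_morphim ?inE.
exists (sdpair1 base_gact f).
  by rewrite inE inE mem_base_group tf perm1 !eqxx Xf.
by rewrite sdpair1_decomp base_partE.
Qed.

End WreathProduct.

(* Main.v *)
Require Import Defs.
From HB Require Import structures.
From mathcomp Require Import all_boot all_fingroup.

Set Implicit Arguments.
Unset Strict Implicit.
Unset Printing Implicit Defensive.

Local Open Scope group_scope.

(** The wreath product also acts on Delta * Gamma, by
    (d, g) (f h) = (d h, g (d f)) (the imprimitive action), and the product
    action is what this action does to graphs: the graph of phi is carried by w
    onto the graph of phi w. Transitivity on functions is thus transitivity on
    graphs, and the components can be read off from orbits on Delta * Gamma.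

    First claim. Let O be an X-orbit on Delta * Gamma. The number of points of
    O on the graph of phi is unchanged by X, hence it is the same for every phi.
    Changing the value of phi at a single d would alter this number if (d, g) is
    in O and (d, g') is not; so each fibre {d} * Gamma lies in one X-orbit
    ([imprimitive_orbit_fibre]), and an element of X that carries (d, g) to
    (d, g') fixes d, so it yields an element of the d-component that carries g
    to g'.

    Second claim. If X is also transitive on Delta, then it is transitive on
    Delta * Gamma. Let N be the intersection of X with the base group; since X
    normalises N, all N-orbits on Delta * Gamma have the same size c. Each of
    them lies in a fibre, because N fixes Delta pointwise, and c = #|Gamma| is
    what has to be shown. Put m = #|Delta| and call two functions equivalent if
    at each d their graphs meet the fibre over d in the same N-orbit. The
    classes have size c ^ m, X permutes them transitively and N fixes each of
    them. Hence #|Gamma| ^ m = k * c ^ m, where the number k of classes divides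
    #|X : N| ([invariant_equivalence_index]), which divides m`! because X / N
    embeds in Sym(Delta). It follows that c divides #|Gamma| and that
    k = q ^ m with q = #|Gamma| / c. But q ^ m divides m`! only if q = 1
    ([expn_dvd_fact]), as a prime has p-adic valuation less than m in m`!. *)

(** * Powers dividing a factorial *)

(** The terms of Legendre's formula at least halve at each step, so the sum
    telescopes to at most n; the strict inequality comes from the invariant of
    the induction, which keeps a spare 1 after the last nonzero term. *)
Lemma logn_fact_lt p n : prime p -> 0 < n -> logn p n`! < n.
Proof.
move=> p_pr n_gt0; rewrite logn_fact //.
have bound j :
    \sum_(1 <= k < j.+1) n %/ p ^ k + maxn 1 (n %/ p ^ j) <= n.
  elim: j => [|j IHj]; first by rewrite big_geq // divn1 geq_max n_gt0 /=.
  rewrite big_nat_recr //= -addnA; apply: leq_trans IHj; rewrite leq_add2l.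
  rewrite expnSr divnMA; move: (n %/ p ^ j)%N => a.
  have [-> | q_gt0] := posnP (a %/ p); first by rewrite leq_maxl.
  rewrite (maxn_idPr q_gt0) addnn -muln2; apply: leq_trans (leq_maxr _ _).
  by apply: leq_trans (leq_divM a p); rewrite leq_mul2l prime_gt1 ?orbT.
by apply: leq_trans (bound n); rewrite -addn1 leq_add2l leq_maxl.
Qed.

Lemma expn_dvd_fact k n : 0 < n -> k ^ n %| n`! -> k = 1%N.
Proof.
move=> n_gt0 k_dvd; apply/eqP/idPn=> k_neq1.
have k_gt1 : 1 < k.
  case: k k_dvd k_neq1 => [|[|k]] //.
  by rewrite exp0n // dvd0n; case: n`! (fact_gt0 n).
have := dvdn_trans (dvdn_exp2r n (pdiv_dvd k)) k_dvd.
have p_pr := pdiv_prime k_gt1.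
by rewrite pfactor_dvdn ?fact_gt0 // leqNgt logn_fact_lt.
Qed.

(** * Blocks of a transitive action *)

Section TransitiveActions.

Variables (aT : finGroupType) (rT : finType) (to : {action aT &-> rT}).
Variables (G N : {group aT}).
Hypothesis trG : [transitive G, on [set: rT] | to].

(** Elements of G that normalise N permute the N-orbits. *)
Lemma card_orbit_normalised x y :
  G \subset 'N(N) -> #|orbit to N x| = #|orbit to N y|.
Proof.
move=> nNG; have [a Ga ->] := atransP2 trG (in_setT x) (in_setT y).
rewrite -(card_imset _ (act_inj to a)); apply: eq_card => z.
apply/imsetP/idP=> [[u xu ->] | ].
  by rewrite -{1}(normsP nNG a Ga) orbit_conjsg.
move=> za; exists (to z a^-1); last by rewrite actKV.
by rewrite -(orbit_conjsg to N a) actKV (normsP nNG).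
Qed.

(** The classes of an invariant equivalence are blocks, and G permutes them
    transitively; their number k is the index of the stabiliser of one of them,
    which contains N. *)
Lemma invariant_equivalence_index (R : rel rT) c :
    equivalence_rel R -> (forall x, #|[set y | R x y]| = c) ->
    (forall a x y, a \in G -> R x y -> R (to x a) (to y a)) ->
    N \subset G -> (forall a x, a \in N -> R x (to x a)) ->
  exists2 k, #|rT| = (k * c)%N & k %| #|G : N|.
Proof.
move=> eqR cardR invR sNG fixR.
have RE x y : R x y -> forall z, R x z = R y z.
  by move=> xy z; case: (eqR x y z) => _ ->.
have invRE a x y : a \in G -> R (to x a) y = R x (to y a^-1).
  move=> Ga; apply/idP/idP=> [/(invR a^-1) | /(invR a)].
    by rewrite actK groupV; apply.
  by rewrite actKV; apply.
pose cls x := [set y | R x y]; pose P := cls @: [set: rT].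
have clsE a x : a \in G -> (to^* (cls x) a)%act = cls (to x a).
  move=> Ga; apply/setP=> y; rewrite inE invRE //.
  by rewrite -{1}(actKV to a y) (mem_imset _ _ (act_inj to a)) inE.
have partP : partition P [set: rT].
  suff -> : P = equivalence_partition R [set: rT].
    by apply: equivalence_partitionP => x y z _ _ _; apply: eqR.
  rewrite /P /equivalence_partition; apply: eq_imset => x /=.
  by apply/setP=> y; rewrite !inE.
exists #|P|.
  rewrite -cardsT; apply: card_uniform_partition partP => A /imsetP[x _ ->].
  exact: cardR.
have [P0 | [_ /imsetP[x _ _]]] := set_0Vmem P.
  have /imsetP[x _ _] := trG.
  by have := imset_f cls (in_setT x); rewrite -/P P0 inE.
have -> : P = orbit to^* G (cls x).
  apply/setP=> A; apply/imsetP/orbitP=> [[y _ ->] | [a Ga <-]].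
    have [a Ga ->] := atransP2 trG (in_setT x) (in_setT y).
    by exists a => //=; rewrite clsE.
  by exists (to x a); rewrite ?inE //= clsE.
rewrite card_orbit indexgS // subsetI sNG; apply/subsetP=> a Na.
have clsN : cls (to x a) = cls x.
  by apply/setP=> y; rewrite !inE (RE _ _ (fixR a x Na)).
by rewrite !inE sub1set inE clsE ?(subsetP sNG) // clsN !eqxx.
Qed.

End TransitiveActions.

(** * The imprimitive action of the wreath product *)

Section ImprimitiveAction.

Variables Gamma Delta : finType.
Local Notation W := (wreath Gamma Delta).
Local Notation prod_act := (product_action Gamma Delta).
Implicit Types (w : W) (d : Delta) (g : Gamma).
Implicit Types phi psi : {ffun Delta -> Gamma}.

Definition imprimitive_act_fun (dg : Delta * Gamma) (w : W) : Delta * Gamma :=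
  (top_part w dg.1, base_part w dg.1 dg.2).

Lemma imprimitive_act1 dg : imprimitive_act_fun dg 1 = dg.
Proof.
case: dg => d g.
by rewrite /imprimitive_act_fun top_part1 base_part1 ffunE !perm1.
Qed.

Lemma imprimitive_actM dg : act_morph imprimitive_act_fun dg.
Proof.
move=> u v; rewrite /imprimitive_act_fun top_partM base_partM.
by move: (base_part u) (base_part v) => f f'; rewrite !ffunE !permM invgK.
Qed.

Canonical imprimitive_action := TotalAction imprimitive_act1 imprimitive_actM.

Local Notation imp_act := imprimitive_action.

(** In the product action a function is moved by moving its graph. *)
Lemma imprimitive_act_graph phi w d :
  imp_act (d, phi d) w = (top_part w d, prod_act phi w (top_part w d)).
Proof.
rewrite /= /imprimitive_act_fun /product_act_fun.
by move: (base_part w) => f; rewrite ffunE permK.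
Qed.

(** An element that moves (d, g) within its fibre fixes d, so that its value at
    d lies in the d-component. *)
Lemma orbit_component (X : {group W}) d g g' :
  (d, g') \in orbit imp_act X (d, g) -> g' \in orbit 'P (component X d) g.
Proof.
case/orbitP=> w Xw [wd <-]; apply/orbitP; exists (base_part w d) => //.
by apply/imsetP; exists w; rewrite // inE Xw wd /=.
Qed.

Lemma trans_component (X : {group W}) d g :
    (forall g', (d, g') \in orbit imp_act X (d, g)) ->
  [transitive component X d, on [set: Gamma] | 'P].
Proof.
move=> trd; apply/imsetP; exists g => //; apply/setP=> g'; rewrite inE.
by rewrite (orbit_component (trd g')).
Qed.

(** The action of w matches the points of the orbit on the graph of phi with
    those on the graph of its image; d is sent to its image in Delta. *)
Lemma card_graph_orbit (X : {group W}) a phi w : w \in X ->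
  #|[set d | (d, prod_act phi w d) \in orbit imp_act X a]|
    = #|[set d | (d, phi d) \in orbit imp_act X a]|.
Proof.
move=> Xw; rewrite -[RHS](card_imset _ (@perm_inj _ (top_part w))).
apply: eq_card => d; rewrite -[d](permKV (top_part w)).
rewrite (mem_imset _ _ (@perm_inj _ _)) !inE -imprimitive_act_graph.
by rewrite orbit_actr.
Qed.

(** Two functions that differ only at d, with values g and g', have graphs that
    meet the orbit of (d, g) equally often. *)
Lemma imprimitive_orbit_fibre (X : {group W}) d g g' :
    [transitive X, on [set: {ffun Delta -> Gamma}] | prod_act] ->
  (d, g') \in orbit imp_act X (d, g).
Proof.
move=> trX; apply/idPn=> notXg'.
pose phi : {ffun Delta -> Gamma} := [ffun=> g].
pose psi : {ffun Delta -> Gamma} := [ffun e => if e == d then g' else g].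
have [w Xw psiE] := atransP2 trX (in_setT phi) (in_setT psi).
have := card_graph_orbit (d, g) phi Xw; rewrite -psiE.
apply/eqP; rewrite neq_ltn proper_card //; apply/properP; split.
  apply/subsetP=> e; rewrite !inE !ffunE; case: eqP => // ->.
  by rewrite (negPf notXg').
by exists d; rewrite inE ffunE ?eqxx ?orbit_refl.
Qed.

Lemma imprimitive_trans (X : {group W}) :
    [transitive X, on [set: {ffun Delta -> Gamma}] | prod_act] ->
    [transitive X, on [set: Delta] | induced_action Gamma Delta] ->
  [transitive X, on [set: Delta * Gamma] | imp_act].
Proof.
move=> trX trD.
have [phi _ _] := imsetP trX; have [d _ _] := imsetP trD.
apply/imsetP; exists (d, phi d) => //; apply/setP=> -[e g]; rewrite inE.
have [w Xw ->] := atransP2 trD (in_setT d) (in_setT e).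
rewrite orbit_sym -(orbit_actr _ _ _ Xw) orbit_sym.
by rewrite imprimitive_orbit_fibre.
Qed.

(** * The intersection with the base group *)

Lemma top_part_morphism_proof :
  {in [set: W] &, {morph @top_part Gamma Delta : u v / u * v}}.
Proof. by move=> u v _ _; apply: top_partM. Qed.

Canonical top_part_morphism := Morphism top_part_morphism_proof.

Lemma ker_top_part : 'ker (@top_part Gamma Delta) = base_group Gamma Delta.
Proof. by apply/setP=> w; rewrite mem_base_group !inE. Qed.

Lemma base_group_norm (X : {group W}) :
  X \subset 'N(X :&: base_group Gamma Delta).
Proof.
apply: normsI; first exact: normG.
by rewrite -ker_top_part; apply: subset_trans (ker_norm _); apply: subsetT.
Qed.

(** The quotient of X by its intersection with the base group embeds in
    Sym(Delta). *)
Lemma index_base_group (X : {group W}) :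
  #|X : X :&: base_group Gamma Delta| %| #|Delta|`!.
Proof.
have -> : #|Delta|`! = #|[set: {perm Delta}]|.
  rewrite -cardsT -card_perm; apply: eq_card => s; rewrite inE.
  by apply/subsetP=> d _; rewrite inE.
rewrite indexgI -ker_top_part -{1}[X : {set _}]setTI -card_morphim.
exact: cardSg (subsetT _).
Qed.

(** The base group fixes Delta pointwise, so its orbits stay in one fibre. *)
Lemma base_orbit_fibre (N : {group W}) d g :
    N \subset base_group Gamma Delta ->
  #|[set g' | (d, g') \in orbit imp_act N (d, g)]| = #|orbit imp_act N (d, g)|.
Proof.
move=> /subsetP sNB.
have inj_d : injective (pair d : Gamma -> _) by move=> ? ? [].
rewrite -(card_imset _ inj_d); apply: eq_card => -[e g'].
apply/imsetP/idP=> [[h + [-> ->]] | eg']; first by rewrite inE.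
have [w /sNB] := orbitP eg'.
rewrite mem_base_group => /eqP tw [].
rewrite tw perm1 => ed _; rewrite -ed in eg' *.
by exists g'; rewrite ?inE.
Qed.

(** The block system of the counting argument: its classes are permuted by the
    normaliser of N and, for N in the base group, fixed by N. *)
Definition orbitwise (N : {group W}) : rel {ffun Delta -> Gamma} :=
  fun phi psi => [forall d, (d, psi d) \in orbit imp_act N (d, phi d)].

Lemma orbitwise_equiv N : equivalence_rel (orbitwise N).
Proof.
move=> phi psi chi; split=> [|/forallP phipsi].
  by apply/forallP=> d; apply: orbit_refl.
apply: eq_forallb => d; rewrite ![(d, chi d) \in _]orbit_sym.
by rewrite (orbit_transl _ (phipsi d)).
Qed.

Lemma orbitwise_act (N : {group W}) w phi psi : w \in 'N(N) ->
  orbitwise N phi psi -> orbitwise N (prod_act phi w) (prod_act psi w).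
Proof.
move=> /normP nNw /forallP phipsi; apply/forallP=> d.
rewrite -[d](permKV (top_part w)) -!imprimitive_act_graph.
by rewrite -nNw orbit_conjsg.
Qed.

Lemma orbitwise_base (N : {group W}) w phi :
  N \subset base_group Gamma Delta -> w \in N ->
  orbitwise N phi (prod_act phi w).
Proof.
move=> /subsetP sNB Nw; apply/forallP=> d.
have := sNB w Nw; rewrite mem_base_group => /eqP tw.
have := imprimitive_act_graph phi w d; rewrite tw perm1 => <-.
exact: mem_orbit.
Qed.

(** A class is a product over Delta of fibres of N-orbits. *)
Lemma card_orbitwise (N : {group W}) phi c :
    N \subset base_group Gamma Delta ->
    (forall dg, #|orbit imp_act N dg| = c) ->
  #|[set psi | orbitwise N phi psi]| = (c ^ #|Delta|)%N.
Proof.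
move=> sNB cN.
pose F d := mem [set g | (d, g) \in orbit imp_act N (d, phi d)].
have -> : #|[set psi | orbitwise N phi psi]| = #|family F|.
  by apply: eq_card => psi; rewrite inE; apply: eq_forallb => d; rewrite !inE.
rewrite card_family foldrE big_map big_enum /= -prod_nat_const.
by apply: eq_bigr => d _; rewrite -(cN (d, phi d)) -base_orbit_fibre.
Qed.

End ImprimitiveAction.

Theorem theorem1p2 (Gamma Delta : finType) (X : {group wreath Gamma Delta}) :
  [transitive X, on [set: {ffun Delta -> Gamma}]
     | product_action Gamma Delta] ->
  (forall d : Delta, [transitive component X d, on [set: Gamma] | 'P])
  /\ ([transitive X, on [set: Delta] | induced_action Gamma Delta] ->
      forall d : Delta,
        [transitive component (X :&: base_group Gamma Delta) d,
           on [set: Gamma] | 'P]).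
Proof.
move=> trX; have [phi _ _] := imsetP trX; split=> [d | trD d].
  by apply: (@trans_component _ _ X d (phi d)) => g;
    apply: imprimitive_orbit_fibre.
pose imp_act := imprimitive_action Gamma Delta.
pose N := (X :&: base_group Gamma Delta)%G.
have sNB : N \subset base_group Gamma Delta by apply: subsetIr.
have nNX : X \subset 'N(N) := base_group_norm X.
pose c := #|orbit imp_act N (d, phi d)|.
have cN dg : #|orbit imp_act N dg| = c.
  exact: card_orbit_normalised (imprimitive_trans trX trD) _ _ nNX.
have [k cardk k_dvd] : exists2 k,
    #|{ffun Delta -> Gamma}| = (k * c ^ #|Delta|)%N & k %| #|X : N|.
  apply: invariant_equivalence_index trX _ _ (orbitwise_equiv N) _ _ _ _.
  - by move=> psi; apply: card_orbitwise.
  - by move=> w psi chi /(subsetP nNX); apply: orbitwise_act.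
  - exact: subsetIl.
  - by move=> w psi; apply: orbitwise_base.
have D_gt0 : 0 < #|Delta| by apply/card_gt0P; exists d.
rewrite card_ffun in cardk.
have : c %| #|Gamma| by rewrite -(dvdn_pexp2r _ _ D_gt0) cardk dvdn_mull.
case/dvdnP=> q Gq.
have kq : k = (q ^ #|Delta|)%N.
  apply/eqP; rewrite -(@eqn_pmul2r (c ^ #|Delta|)) -?cardk ?Gq ?expnMn //.
  by rewrite expn_gt0 /c (cardD1 (d, phi d)) orbit_refl.
have q1 : q = 1%N.
  by apply: expn_dvd_fact D_gt0 _; rewrite -kq (dvdn_trans k_dvd) //
    index_base_group.
rewrite q1 mul1n in Gq.
apply: (@trans_component _ _ N d (phi d)) => g.
have /setP/(_ g) :
  [set g | (d, g) \in orbit imp_act N (d, phi d)] = [set: Gamma].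
  by apply/eqP; rewrite eqEcard subsetT cardsT Gq base_orbit_fibre ?leqnn.
by rewrite !inE.
Qed.
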